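(* For every $\mathcal{L}$-sentence $\varphi$ there exist $N\in\mathbb{N}$, $d\in\mathbb{N}_{>0}$, $\mathfrak{i}\subseteq\{0,\dots,N\}$ and $\mathfrak{r}\subseteq\{1,\dots,d\}$ such that \[ T_{\mathrm{MSO(Fin)}}\models\varphi\leftrightarrow\Big(\bigvee_{i\in\mathfrak{i}}\psi_{=i}\vee\big(\psi_{>N}\wedge\bigvee_{h\in\mathfrak{r}}\rho_{d,h}\big)\Big).\]
   Context: $\mathbb{N}=\{0,1,2,\dots\}$. Let $\mathcal{L}=\{\subseteq,\bot,\mathrm{At},\lhd\}$ be the first-order language with binary relation symbols $\subseteq,\lhd$, a constant $\bot$ and a unary relation symbol $\mathrm{At}$. Lowercase variables range over atoms; $X(x)$ abbreviates $x\subseteq X$. $T_{\mathrm{base}}$ states: $\subseteq$ is an atomic Boolean algebra order (one-element algebra allowed); $\lhd$ linearly orders the atoms; $\bot$ is least; $\mathrm{At}$ holds exactly of atoms; $\forall X\forall Y(X\lhd Y\leftrightarrow\exists x\exists y(X(x)\wedge Y(y)\wedge x\lhd y))$; and for every $\mathcal{L}$-formula $\eta(x;\bar Y)$, $\forall\bar Y\exists X\forall x(X(x)\leftrightarrow\eta(x;\bar Y))$. $T_{\mathrm{MSO(Fin)}}$ is $T_{\mathrm{base}}$ plus: the order on atoms is discrete with endpoints, and every $X\neq\bot$ contains a $\lhd$-least atom. In its models $0$ and $0^*$ denote the least and greatest atoms. $\psi_{=n}$ says there are exactly $n$ atoms; $\psi_{>n}$ says there are at least $n+1$ atoms. For $d\ge1$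 and $1\le h\le d$, $\rho_{d,h}$ says: there exist non-bottom elements $A_1,\dots,A_d$ partitioning the set of atoms such that $A_1(0)$; for every atom $a\neq0^*$ and $1\le i\le d$, $A_i(a)$ implies $A_{i'}(a')$ where $a'$ is the immediate successor of $a$ and $i'$ is $i+1$ if $i<d$ and $1$ if $i=d$; and $A_h(0^* )$. *)

(* Defs.v *)
From mathcomp Require Import all_boot.

Set Implicit Arguments.
Unset Strict Implicit.
Unset Printing Implicit Defensive.

(* Variables are named by natural numbers.                                    *)
Inductive term := Var of nat | tBot.
Coercion Var : nat >-> term.

Inductive formula :=
  | fEq of term & term
  | fSub of term & term
  | fLhd of term & term
  | fAt of term
  | fFalse
  | fAnd of formula & formula
  | fOr of formula & formula
  | fImp of formula & formula
  | fAll of nat & formula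
  | fEx of nat & formula.

Definition fv_term (t : term) : seq nat := if t is Var v then [:: v] else [::].

Fixpoint fv (f : formula) : seq nat :=
  match f with
  | fEq s t | fSub s t | fLhd s t => fv_term s ++ fv_term t
  | fAt t => fv_term t
  | fFalse => [::]
  | fAnd f g | fOr f g | fImp f g => fv f ++ fv g
  | fAll v f | fEx v f => [seq w <- fv f | w != v]
  end.

Definition sentence (f : formula) : Prop := fv f = [::].

Record structure := Structure {
  dom :> Type;
  isub : dom -> dom -> Prop;
  ibot : dom;
  iat : dom -> Prop;
  ilhd : dom -> dom -> Prop }.

Definition upd (M : Type) (e : nat -> M) (v : nat) (a : M) : nat -> M :=
  fun w => if w == v then a else e w.

Definition eval (M : structure) (e : nat -> M) (t : term) : M :=
  if t is Var v then e v else ibot M.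

Fixpoint sat (M : structure) (e : nat -> M) (f : formula) : Prop :=
  match f with
  | fEq s t => eval e s = eval e t
  | fSub s t => isub (eval e s) (eval e t)
  | fLhd s t => ilhd (eval e s) (eval e t)
  | fAt t => iat (eval e t)
  | fFalse => False
  | fAnd f g => sat e f /\ sat e g
  | fOr f g => sat e f \/ sat e g
  | fImp f g => sat e f -> sat e g
  | fAll v f => forall a : M, sat (upd e v a) f
  | fEx v f => exists a : M, sat (upd e v a) f
  end.

Definition models (M : structure) (T : formula -> Prop) : Prop :=
  forall f, T f -> forall e : nat -> M, sat e f.

Definition entails (T : formula -> Prop) (f : formula) : Prop :=
  forall M : structure, models M T -> forall e : nat -> M, sat e f.

Declare Scope fo_scope.
Delimit Scope fo_scope with fo.
Bind Scope fo_scope with formula.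
Notation "s ≐ t" := (fEq s t) (at level 70, no associativity) : fo_scope.
Notation "s ⊆ t" := (fSub s t) (at level 70, no associativity) : fo_scope.
Notation "s ⊲ t" := (fLhd s t) (at level 70, no associativity) : fo_scope.
Notation "f /\ g" := (fAnd f g) : fo_scope.
Notation "f \/ g" := (fOr f g) : fo_scope.
Notation "f ⇒ g" := (fImp f g) (at level 90, right associativity) : fo_scope.
Notation "~ f" := (fImp f fFalse) : fo_scope.
Notation "f <-> g" := (fAnd (fImp f g) (fImp g f)) : fo_scope.

Local Open Scope fo_scope.

Definition conj_over (I : Type) (s : seq I) (F : I -> formula) : formula :=
  foldr (fun i g => F i /\ g) (~ fFalse) s.
Definition disj_over (I : Type) (s : seq I) (F : I -> formula) : formula :=
  foldr (fun i g => F i \/ g) fFalse s.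

Definition alls (vs : seq nat) (f : formula) : formula := foldr fAll f vs.
Definition exs (vs : seq nat) (f : formula) : formula := foldr fEx f vs.

Definition alls_at (vs : seq nat) (f : formula) : formula :=
  foldr (fun v g => fAll v (fAt v ⇒ g)) f vs.
Definition exs_at (vs : seq nat) (f : formula) : formula :=
  foldr (fun v g => fEx v (fAt v /\ g)) f vs.

Definition closure (f : formula) : formula := alls (fv f) f.

(* Macros bind this name, so as not to capture their arguments.              *)
Definition fresh (ts : seq term) : nat :=
  foldr (fun t m => maxn (if t is Var v then v.+1 else 0) m) 0 ts.

Definition is_top (z : term) : formula :=
  let w := fresh [:: z] in alls [:: w] (w ⊆ z).

Definition is_meet (z x y : term) : formula :=
  let w := fresh [:: z; x; y] in
  alls [:: w] (w ⊆ z <-> (w ⊆ x /\ w ⊆ y)).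

Definition is_join (z x y : term) : formula :=
  let w := fresh [:: z; x; y] in
  alls [:: w] (z ⊆ w <-> (x ⊆ w /\ y ⊆ w)).

Definition is_least_atom (x : term) : formula :=
  let y := fresh [:: x] in
  fAt x /\ alls_at [:: y] (x ≐ y \/ x ⊲ y).

Definition is_greatest_atom (x : term) : formula :=
  let y := fresh [:: x] in
  fAt x /\ alls_at [:: y] (y ≐ x \/ y ⊲ x).

Definition is_succ (x y : term) : formula :=
  let z := fresh [:: x; y] in
  fAt x /\ fAt y /\ x ⊲ y /\ ~ exs_at [:: z] (x ⊲ z /\ z ⊲ y).

Local Notation X := 0.
Local Notation Y := 1.
Local Notation Z := 2.
Local Notation x := 3.
Local Notation y := 4.
Local Notation z := 5.

Inductive T_base : formula -> Prop :=
  | ax_refl : T_base (alls [:: X] (X ⊆ X))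
  | ax_antisym :
      T_base (alls [:: X; Y] (X ⊆ Y ⇒ (Y ⊆ X ⇒ X ≐ Y)))
  | ax_trans :
      T_base (alls [:: X; Y; Z] (X ⊆ Y ⇒ (Y ⊆ Z ⇒ X ⊆ Z)))
  | ax_bot : T_base (alls [:: X] (tBot ⊆ X))
  | ax_top : T_base (exs [:: X] (is_top X))
  | ax_meet : T_base (alls [:: X; Y] (exs [:: Z] (is_meet Z X Y)))
  | ax_join : T_base (alls [:: X; Y] (exs [:: Z] (is_join Z X Y)))
  | ax_distr :
      (* X ∧ (Y ∨ Z) = (X ∧ Y) ∨ (X ∧ Z), with 6 = Y ∨ Z, 7 = X ∧ Y,           *)
      (* 8 = X ∧ Z and 9, 10 the two sides                                    *)
      T_base (alls [:: X; Y; Z; 6; 7; 8; 9; 10]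
        (is_join 6 Y Z ⇒ (is_meet 7 X Y ⇒ (is_meet 8 X Z ⇒
         (is_meet 9 X 6 ⇒ (is_join 10 7 8 ⇒ 9 ≐ 10))))))
  | ax_compl :
      T_base (alls [:: X] (exs [:: Y; Z]
        (is_top Z /\ is_meet tBot X Y /\ is_join Z X Y)))
  | ax_atom :
      T_base (alls [:: X] (fAt X <->
        (~ (X ≐ tBot) /\ alls [:: Y] (Y ⊆ X ⇒ (Y ≐ tBot \/ Y ≐ X)))))
  | ax_atomic :
      T_base (alls [:: X] (~ (X ≐ tBot) ⇒ exs_at [:: x] (x ⊆ X)))
  (* ⊲ is read as a strict order. *)
  | ax_lhd_irrefl : T_base (alls_at [:: x] (~ (x ⊲ x)))
  | ax_lhd_trans :
      T_base (alls_at [:: x; y; z] (x ⊲ y ⇒ (y ⊲ z ⇒ x ⊲ z)))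
  | ax_lhd_total :
      T_base (alls_at [:: x; y] (x ⊲ y \/ x ≐ y \/ y ⊲ x))
  | ax_lhd :
      T_base (alls [:: X; Y]
        (X ⊲ Y <-> exs_at [:: x; y] (x ⊆ X /\ y ⊆ Y /\ x ⊲ y)))
  (* Variables of eta other than u are the parameters. *)
  | ax_comprehension (eta : formula) (u V : nat) :
      V != u -> V \notin fv eta ->
      T_base (closure (exs [:: V] (alls_at [:: u] (u ⊆ V <-> eta)))).

(* Existence of endpoints is conditional on there being an atom, so that the  *)
(* one-element algebra remains a model.                                       *)
Inductive T_MSO_Fin : formula -> Prop :=
  | ax_base f : T_base f -> T_MSO_Fin f
  | ax_least_atom :
      T_MSO_Fin (exs_at [:: x] (~ fFalse) ⇒ exs_at [:: x] (is_least_atom x))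
  | ax_greatest_atom :
      T_MSO_Fin (exs_at [:: x] (~ fFalse) ⇒ exs_at [:: x] (is_greatest_atom x))
  | ax_succ :
      T_MSO_Fin (alls_at [:: x]
        (~ is_greatest_atom x ⇒ exs_at [:: y] (is_succ x y)))
  | ax_pred :
      T_MSO_Fin (alls_at [:: x]
        (~ is_least_atom x ⇒ exs_at [:: y] (is_succ y x)))
  | ax_least :
      T_MSO_Fin (alls [:: X] (~ (X ≐ tBot) ⇒
        exs_at [:: x] (x ⊆ X /\
          alls_at [:: y] (y ⊆ X ⇒ (x ≐ y \/ x ⊲ y))))).

Definition distinct (n : nat) : formula :=
  conj_over (iota 0 n) (fun i => conj_over (iota 0 i) (fun j => ~ (i ≐ j))).

Definition psi_eq (n : nat) : formula :=
  exs_at (iota 0 n)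
    (distinct n /\ alls_at [:: n] (disj_over (iota 0 n) (fun i => n ≐ i))).

Definition psi_gt (n : nat) : formula :=
  exs_at (iota 0 n.+1) (distinct n.+1).

Local Notation a := 0.
Local Notation a' := 1.

(* Variable i.+1 stands for A_i, for 1 <= i <= d.                             *)
Definition rho (d h : nat) : formula :=
  let A i : term := i.+1 in
  exs [seq i.+1 | i <- iota 1 d]
    (conj_over (iota 1 d) (fun i => ~ (A i ≐ tBot)) /\
     alls_at [:: a] (disj_over (iota 1 d) (fun i => a ⊆ A i)) /\
     alls_at [:: a] (conj_over (iota 1 d) (fun i =>
       conj_over (iota 1 i.-1) (fun j => ~ (a ⊆ A i /\ a ⊆ A j)))) /\
     exs_at [:: a] (is_least_atom a /\ a ⊆ A 1) /\
     alls_at [:: a] (~ is_greatest_atom a ⇒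
       alls_at [:: a'] (is_succ a a' ⇒
         conj_over (iota 1 d) (fun i =>
           a ⊆ A i ⇒ a' ⊆ A (if i < d then i.+1 else 1)))) /\
     exs_at [:: a] (is_greatest_atom a /\ a ⊆ A h)).

(* Main.v *)
Require Import Defs.
From mathcomp Require Import all_boot.
From Stdlib Require Import Classical_Prop.

(* To every formula one attaches a finite deterministic automaton reading the
   atoms in increasing order, the letter at an atom recording which of the
   assigned sets contain it; set quantifiers are handled by the powerset
   construction.  Instead of producing runs inside a model, one defines
   semantically the state reached on a cut C of the atoms: for a quantifier, the
   set of all states reached on C when the quantified set varies.  This state is
   a function of C, depends only on the traces of the sets on C, changes by the
   transition function when one atom is added on top of C, and determines the
   truth of the formula when C contains all atoms.  For C = {x | x <= a} it is
   moreover definable in a, so comprehension and the least element principle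
   give induction along the atoms, also in models with infinitely many atoms.

   For a sentence only one letter matters, so the automaton iterates one function
   on a finite set and its orbit is a lasso with tail n0 and period n1 - n0.
   Since the states of index below n1 are pairwise distinct, the states reached
   define the residue classes modulo the period, which yields the sets required
   by rho; conversely any such sets agree with these classes by induction. *)

Set Implicit Arguments.
Unset Strict Implicit.
Unset Printing Implicit Defensive.

(** * Satisfaction and definability *)

Section Satisfaction.
Variable M : structure.
Implicit Types (e : nat -> M) (f : formula).

Lemma eval_eq_in e e' t : {in fv_term t, e =1 e'} -> eval e t = eval e' t.
Proof. by case: t => [v|] //= H; apply: H; rewrite inE. Qed.

Lemma upd_eq_in e e' v A f :
  {in [seq w <- fv f | w != v], e =1 e'} ->
  {in fv f, upd e v A =1 upd e' v A}.
Proof.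
move=> H w wf; rewrite /upd; case: (eqVneq w v) => // wv.
by apply: H; rewrite mem_filter wv.
Qed.

Lemma sat_eq_in f e e' : {in fv f, e =1 e'} -> sat e f <-> sat e' f.
Proof.
elim: f e e' => [s t|s t|s t|t||f IHf g IHg|f IHf g IHg|f IHf g IHg|v f IHf|v f IHf]
  e e' H //=.
1-3: rewrite (@eval_eq_in e e' s) ?(@eval_eq_in e e' t) // => w wf;
  by apply: H; rewrite /= mem_cat wf ?orbT.
- by rewrite (@eval_eq_in e e' t).
1-3: have Hf : sat e f <-> sat e' f by apply: IHf => w wf;
  apply: H; rewrite /= mem_cat wf.
1-3: have Hg : sat e g <-> sat e' g by apply: IHg => w wg;
  apply: H; rewrite /= mem_cat wg orbT.
1-3: tauto.
all: have Hv A : sat (upd e v A) f <-> sat (upd e' v A) f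
  by apply: IHf; apply: upd_eq_in H.
- by split=> K A; apply/Hv.
- by split=> -[A K]; exists A; apply/Hv.
Qed.

Lemma sat_ext f e e' : e =1 e' -> sat e f <-> sat e' f.
Proof. by move=> H; apply: sat_eq_in => v _. Qed.

Lemma sat_alls vs f e : sat e (alls vs f) -> sat e f.
Proof.
elim: vs e => //= v vs IH e /(_ (e v)) /IH /sat_ext; apply=> w.
by rewrite /upd; case: eqP => [->|].
Qed.

Lemma sat_exs vs f e :
  sat e (exs vs f) <->
  exists e', (forall w, w \notin vs -> e' w = e w) /\ sat e' f.
Proof.
elim: vs e => [|v vs IH] e /=.
  split=> [H|[e' [H /sat_ext]]]; first by exists e.
  by apply=> w; rewrite H.
split=> [[A /IH [e' [H K]]]|[e' [H K]]].
  exists e'; split=> // w; rewrite inE negb_or => /andP[wv wvs].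
  by rewrite H // /upd (negPf wv).
exists (e' v); apply/IH; exists e'; split=> // w wvs; rewrite /upd.
by case: eqVneq => [->|wv] //; apply: H; rewrite inE negb_or wv.
Qed.

Lemma sat_exs_at vs f e :
  sat e (exs_at vs f) <->
  exists e', [/\ forall w, w \notin vs -> e' w = e w,
    {in vs, forall w, iat (e' w)} & sat e' f].
Proof.
elim: vs e => [|v vs IH] e /=.
  split=> [H|[e' [H _ /sat_ext]]]; first by exists e.
  by apply=> w; rewrite H.
split=> [[A [At /IH [e' [H K L]]]]|[e' [H K L]]].
  exists e'; split=> // w.
    rewrite inE negb_or => /andP[wv wvs].
    by rewrite H // /upd (negPf wv).
  move: At; rewrite inE /= /upd eqxx => At.
  case: (boolP (w \in vs)) => [/K //|wvs]; rewrite orbF => /eqP wv.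
  by rewrite H // /upd wv eqxx.
exists (e' v); split; first by rewrite /upd eqxx; apply: K; rewrite inE eqxx.
apply/IH; exists e'; split=> // w wvs; last by apply: K; rewrite inE wvs orbT.
rewrite /upd; case: eqVneq => [->|wv] //; apply: H.
by rewrite inE negb_or wv.
Qed.

Lemma sat_disj_over (I : eqType) (s : seq I) (F : I -> formula) e :
  sat e (disj_over s F) <-> exists2 i, i \in s & sat e (F i).
Proof.
elim: s => [|i s IH] /=; first by split=> // -[].
split=> [[H|/IH [j js H]]|[j]].
- by exists i; rewrite // inE eqxx.
- by exists j; rewrite // inE js orbT.
- by rewrite inE => /orP[/eqP->|js] H; [left | right; apply/IH; exists j].
Qed.

Lemma sat_conj_over (I : eqType) (s : seq I) (F : I -> formula) e :
  sat e (conj_over s F) <-> {in s, forall i, sat e (F i)}.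
Proof.
elim: s => [|i s IH] /=; first by split.
split=> [[H /IH K] j|H].
  by rewrite inE => /orP[/eqP->|/K].
split; first by apply: H; rewrite inE eqxx.
by apply/IH => j js; apply: H; rewrite inE js orbT.
Qed.

(** A property of whole assignments: parameters are the values of further variables, so no tuples
    have to be handled. *)
Definition definable (P : (nat -> M) -> Prop) :=
  exists f, forall e, sat e f <-> P e.

Lemma definable_ext (P Q : (nat -> M) -> Prop) :
  (forall e, P e <-> Q e) -> definable P -> definable Q.
Proof. by move=> H [f K]; exists f => e; rewrite K H. Qed.

Lemma definable_and P Q :
  definable P -> definable Q -> definable (fun e => P e /\ Q e).
Proof. by move=> [f H] [g K]; exists (fAnd f g) => e /=; rewrite H K. Qed.

Lemma definable_or P Q :
  definable P -> definable Q -> definable (fun e => P e \/ Q e).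
Proof. by move=> [f H] [g K]; exists (fOr f g) => e /=; rewrite H K. Qed.

Lemma definable_imp P Q :
  definable P -> definable Q -> definable (fun e => P e -> Q e).
Proof.
by move=> [f H] [g K]; exists (fImp f g) => e /=; move: (H e) (K e); tauto.
Qed.

Lemma definable_ex v P :
  definable P -> definable (fun e => exists A, P (upd e v A)).
Proof.
move=> [f H]; exists (fEx v f) => e /=.
by split=> -[A K]; exists A; apply/H.
Qed.

Lemma definable_const (p : Prop) : definable (fun _ : nat -> M => p).
Proof.
case: (classic p) => H.
  by exists (fImp fFalse fFalse) => e /=; split.
by exists fFalse => e /=; split=> // /H.
Qed.

Lemma definable_iff (b : bool) P :
  definable P -> definable (fun e => b <-> P e).
Proof.
move=> dP; case: b.
  by apply: definable_ext dP => e; split=> [H|[H _]]; [split | apply: H].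
apply: definable_ext (definable_imp dP (definable_const False)) => e.
by split=> [H|[_ H]] => [|/H //]; split.
Qed.

Lemma definable_all_in (I : eqType) (s : seq I) P :
  (forall i, definable (P i)) ->
  definable (fun e => {in s, forall i, P i e}).
Proof.
move=> dP; elim: s => [|i s IH].
  by apply: definable_ext (definable_const True) => e; split.
apply: definable_ext (definable_and (dP i) IH) => e; split=> [[H K] j|H].
  by rewrite inE => /orP[/eqP->|/K].
by split=> [|j js]; apply: H; rewrite inE ?eqxx ?js ?orbT.
Qed.

Lemma definable_ex_in (I : eqType) (s : seq I) P :
  (forall i, definable (P i)) ->
  definable (fun e => exists2 i, i \in s & P i e).
Proof.
move=> dP; elim: s => [|i s IH].
  by apply: definable_ext (definable_const False) => e; split=> // -[].
apply: definable_ext (definable_or (dP i) IH) => e; split.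
  move=> [H|[j js H]]; first by exists i; rewrite ?inE ?eqxx.
  by exists j; rewrite ?inE ?js ?orbT.
move=> [j]; rewrite inE => /orP[/eqP->|js]; first by left.
by right; exists j.
Qed.

End Satisfaction.

(** * Consequences of the axioms *)

Section Model.
Variable M : structure.
Hypothesis M_models : models M T_MSO_Fin.
Implicit Types (A B : M) (a b x y : M) (e : nat -> M).

Let bot : nat -> M := fun=> ibot M.
Let base f (H : T_base f) := M_models (ax_base H) bot.

Lemma isubxx A : isub A A.
Proof. exact: (base ax_refl A). Qed.

Lemma isub_antisym A B : isub A B -> isub B A -> A = B.
Proof. exact: (base ax_antisym A B). Qed.

Lemma isub_trans B A C : isub A B -> isub B C -> isub A C.
Proof. exact: (base ax_trans A B C). Qed.

Lemma iatP A :
  iat A <-> A <> ibot M /\ forall B, isub B A -> B = ibot M \/ B = A.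
Proof. exact: (base ax_atom A). Qed.

Lemma atom_sub_atom a b : iat a -> iat b -> isub a b -> a = b.
Proof.
move=> /iatP[a0 _] /iatP[_ H] /H[]; first by move/a0. by [].
Qed.

Lemma atom_not_sub_bot a : iat a -> ~ isub a (ibot M).
Proof.
by move=> /iatP[a0 _] H; apply: a0; apply: isub_antisym => //; apply: (base ax_bot).
Qed.

Lemma exists_atom A : A <> ibot M -> exists2 a, iat a & isub a A.
Proof. by move/(base ax_atomic A) => [a [H K]]; exists a. Qed.

(** With [B'] the complement of [B], the meet of [A] and [B'] contains no atom, hence is bottom by
    atomicity. Distributivity then shows that [A] is the join of bottom and [V], the meet of [A] and
    [B]. *)
Lemma isub_atoms A B :
  (forall a, iat a -> isub a A -> isub a B) -> isub A B.
Proof.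
move=> H.
have [B' [I [Itop [BB' BBI]]]] := base ax_compl B.
have [V VP] := base ax_meet A B.
have AIA : sat (upd (upd (upd bot 0 A) 1 I) 2 A) (is_meet 2 0 1).
  move=> C; split=> [CA|[]//]; split=> //; exact: (Itop C).
have AB' : sat (upd (upd (upd bot 0 A) 1 B') 2 (ibot M)) (is_meet 2 0 1).
  move=> C; split=> [C0|[/= CA CB']].
    by split; apply: isub_trans C0 (base ax_bot _).
  apply: NNPP => C0; have [|a aA aC] := @exists_atom C.
    by move=> C0'; apply: C0; rewrite C0'; apply: isubxx.
  apply: (atom_not_sub_bot aA); apply/(BB' a); split.
    by apply: H => //; apply: isub_trans CA.
  exact: isub_trans CB'.
have VV : sat (upd (upd (upd bot 0 V) 1 (ibot M)) 2 V) (is_join 2 0 1).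
  move=> C; split=> [VC|[]//]; split=> //; exact: (base ax_bot C).
have -> : A = V := base ax_distr A B B' I V (ibot M) A V BBI VP AB' AIA VV.
by have [] := (VP V).1 (isubxx V).
Qed.

(** By totality of the order on atoms, being an atom is expressed by the atoms inside [A] and their
    order, which an automaton reading the atoms can check. *)
Lemma iat_unique A :
  iat A <-> (exists2 a, iat a & isub a A) /\
            ~ exists a b, [/\ iat a, iat b, isub a A, isub b A & ilhd a b].
Proof.
split=> [AA|[[a aA aS] H]].
  split; first by exists A; last exact: isubxx.
  move=> [a [b [aa ab aS bS]]].
  rewrite (atom_sub_atom aa AA aS) (atom_sub_atom ab AA bS).
  exact: (base ax_lhd_irrefl A AA).
suff <- : a = A by [].
apply: isub_antisym => //; apply: isub_atoms => b ab bS.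
have [K|[K|K]] := base ax_lhd_total a aA b ab.
- by case: H; exists a, b.
- by rewrite -[b]K; apply: isubxx.
- by case: H; exists b, a.
Qed.

Lemma ilhd_irrefl a : iat a -> ~ ilhd a a.
Proof. exact: (base ax_lhd_irrefl a). Qed.

Lemma ilhd_trans b a c :
  iat a -> iat b -> iat c -> ilhd a b -> ilhd b c -> ilhd a c.
Proof. by move=> aA bA; apply: (base ax_lhd_trans a aA b bA c). Qed.

Lemma ilhd_total a b : iat a -> iat b -> [\/ ilhd a b, a = b | ilhd b a].
Proof.
by move=> aA bA; have [H|[H|H]] := base ax_lhd_total a aA b bA; constructor.
Qed.

Lemma ilhd_sets A B :
  ilhd A B <-> exists a b, [/\ iat a, iat b, isub a A, isub b B & ilhd a b].
Proof.
apply: (iff_trans (base ax_lhd A B)); split.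
  by move=> [a [? [b [? [? [? ?]]]]]]; exists a, b.
by move=> [a [b [? ? ? ? ?]]]; exists a; split=> //; exists b.
Qed.

(** * The order of the atoms, comprehension and induction *)

Definition ileq a b := a = b \/ ilhd a b.

Definition least_atom a := iat a /\ forall b, iat b -> ileq a b.
Definition greatest_atom a := iat a /\ forall b, iat b -> ileq b a.
Definition succ_atom a b :=
  [/\ iat a, iat b, ilhd a b &
      ~ exists c, [/\ iat c, ilhd a c & ilhd c b]].

Lemma least_atomE e v : sat e (is_least_atom (Var v)) <-> least_atom (e v).
Proof.
by rewrite /least_atom /is_least_atom /= /upd maxn0 eqxx ltn_eqF.
Qed.

Lemma greatest_atomE e v :
  sat e (is_greatest_atom (Var v)) <-> greatest_atom (e v).
Proof.
by rewrite /greatest_atom /is_greatest_atom /= /upd maxn0 eqxx ltn_eqF.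
Qed.

Lemma succ_atomE e v w :
  sat e (is_succ (Var v) (Var w)) <-> succ_atom (e v) (e w).
Proof.
rewrite /succ_atom /is_succ /= /upd maxn0 eqxx.
rewrite !ltn_eqF ?leq_maxl ?leq_maxr //.
split=> [[? [? [? H]]]|[? ? ? H]].
  by split=> // -[c [? ? ?]]; apply: H; exists c.
by split=> //; split=> //; split=> // -[c [? [? ?]]]; apply: H; exists c.
Qed.

Lemma exists_least_atom a : iat a -> exists b, least_atom b.
Proof.
move=> aA; have [|b [_ H]] := M_models ax_least_atom bot.
  by exists a; split=> [|[]].
by exists b; apply/(least_atomE (upd bot 3 b) 3).
Qed.

Lemma exists_greatest_atom a : iat a -> exists b, greatest_atom b.
Proof.
move=> aA; have [|b [_ H]] := M_models ax_greatest_atom bot.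
  by exists a; split=> [|[]].
by exists b; apply/(greatest_atomE (upd bot 3 b) 3).
Qed.

Lemma exists_pred_atom a : iat a -> ~ least_atom a -> exists b, succ_atom b a.
Proof.
move=> aA H; have [|b [_ K]] := M_models ax_pred bot a aA.
  by move/(least_atomE (upd bot 3 a) 3)/H.
by exists b; apply/(succ_atomE (upd (upd bot 3 a) 4 b) 4 3).
Qed.

Lemma exists_least_in A : A <> ibot M ->
  exists a, [/\ iat a, isub a A & forall b, iat b -> isub b A -> ileq a b].
Proof.
move=> /(M_models ax_least bot A) [a [? [? H]]].
by exists a; split=> // b; apply: H.
Qed.

Lemma comprehension P e u : definable P ->
  exists X, forall x, iat x -> isub x X <-> P (upd e u x).
Proof.
move=> [f H].
(* [V] lies above [u] and above every free variable of [f], which secures both side conditions of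
   the comprehension axiom. *)
pose V := (\max_(v <- u :: fv f) v).+1.
have ltV v : v \in u :: fv f -> v < V by move=> H'; apply: (leq_bigmax_seq (F := id)).
have Vu : V != u by rewrite neq_ltn ltV ?inE ?eqxx ?orbT.
have Vf : V \notin fv f.
  by apply/negP => Vf; have := ltV V; rewrite ltnn inE Vf orbT => /(_ isT).
have [X HX] := sat_alls (M_models (ax_base (ax_comprehension Vu Vf)) e).
exists X => x xA; have := HX x.
rewrite /= /upd eqxx (negPf Vu) eqxx => /(_ xA) [H1 H2].
have K : sat (upd (upd e V X) u x) f <-> sat (upd e u x) f.
  apply: sat_eq_in => w wf; rewrite /upd; case: eqP => // _.
  by case: eqP => // wV; rewrite -wV wf in Vf.
split=> [/H1/K/H //|/H/K]; exact: H2.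
Qed.

(** Minimal counterexample: comprehension collects the atoms where [P] fails, and the predecessor of
    the least of them satisfies [P]. *)
Lemma atom_induction P e u : definable P ->
  (forall a, least_atom a -> P (upd e u a)) ->
  (forall a b, succ_atom a b -> P (upd e u a) -> P (upd e u b)) ->
  forall a, iat a -> P (upd e u a).
Proof.
move=> dP P0 PS a aA; apply: NNPP => nPa.
have [X HX] := comprehension e u (definable_imp dP (definable_const M False)).
have [X0|b [bA bX bmin]] := @exists_least_in X.
  by apply: (@atom_not_sub_bot a) => //; rewrite -X0; apply/HX.
have /(HX _ bA) nPb := bX; apply: nPb.
case: (classic (least_atom b)) => [/P0 //|/(exists_pred_atom bA)[c cb]].
apply: (PS c b) => //; have [cA _ clb _] := cb.
apply: NNPP => /(HX _ cA) /(bmin _ cA) [bc|blc].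
  by rewrite bc in clb; apply: ilhd_irrefl clb.
by apply: (ilhd_irrefl bA); apply: ilhd_trans blc clb.
Qed.

(** Changing a set at the single atom [a] realises an arbitrary bit there; the powerset transition
    relies on this. *)
Lemma insert_atom A a (b : bool) : iat a ->
  exists B, (b <-> isub a B) /\
    forall x, iat x -> x <> a -> (isub x B <-> isub x A).
Proof.
move=> aA.
have dA : definable (M := M) (fun e => isub (e 2) (e 0)) by exists (fSub 2 0).
have da : definable (M := M) (fun e => e 2 = e 1) by exists (fEq 2 1).
have [B HB] := comprehension (upd (upd bot 0 A) 1 a) 2
  (definable_or (definable_and (definable_imp da (definable_const M False)) dA)
                (definable_and da (definable_const M b))).
exists B; split.
  apply: (iff_trans _ (iff_sym (HB a aA))); rewrite /upd /=.
  by split=> [H|[[]|[]]] //; right.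
move=> x xA xa; apply: (iff_trans (HB x xA)); rewrite /upd /=.
by split=> [[[]|[/xa]]|H] //; left.
Qed.

End Model.

(** * The automaton of a formula *)

(** What has to be remembered. For [fSub]: whether some atom read so far lies in the left set only;
    for [fEq] the same in both directions. For [fLhd]: whether the left set has been met, and
    whether an atom of the right set came strictly later; for [fAt] the same with both sets equal.
    The two quantifiers share the powerset and differ in acceptance only. *)
Fixpoint state (f : formula) : finType :=
  match f with
  | fFalse => unit
  | fSub _ _ => bool
  | fEq _ _ | fLhd _ _ | fAt _ => (bool * bool)%type
  | fAnd f g | fOr f g | fImp f g => (state f * state g)%type
  | fAll _ f | fEx _ f => {set state f}
  end.

Fixpoint init (f : formula) : state f :=
  match f with
  | fFalse => tt
  | fSub _ _ => false
  | fEq _ _ | fLhd _ _ | fAt _ => (false, false)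
  | fAnd f g | fOr f g | fImp f g => (init f, init g)
  | fAll _ f | fEx _ f => [set init f]
  end.

Definition letter (l : nat -> bool) (t : term) : bool :=
  if t is Var v then l v else false.

Definition step_diff (l : nat -> bool) s t b : bool := b || letter l s && ~~ letter l t.
(** [b] is the flag from before the current atom, so the pair that is detected is strictly
    increasing. *)
Definition step_lt (l : nat -> bool) t b c : bool := c || b && letter l t.

Fixpoint step (f : formula) (l : nat -> bool) : state f -> state f :=
  match f with
  | fFalse => id
  | fSub s t => step_diff l s t
  | fEq s t => fun q => (step_diff l s t q.1, step_diff l t s q.2)
  | fLhd s t => fun q => (step_diff l s tBot q.1, step_lt l t q.1 q.2)
  | fAt t => fun q => (step_diff l t tBot q.1, step_lt l t q.1 q.2)
  | fAnd f g | fOr f g | fImp f g => fun q => (step l q.1, step l q.2)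
  | fAll v f | fEx v f => fun Q =>
      [set p | [exists q in Q, exists b, p == step (upd l v b) q]]
  end.

Fixpoint accepting (f : formula) : pred (state f) :=
  match f with
  | fFalse => pred0
  | fSub _ _ => negb
  | fEq _ _ => fun q => ~~ q.1 && ~~ q.2
  | fLhd _ _ => fun q => q.2
  | fAt _ => fun q => q.1 && ~~ q.2
  | fAnd f g => fun q => accepting q.1 && accepting q.2
  | fOr f g => fun q => accepting q.1 || accepting q.2
  | fImp f g => fun q => accepting q.1 ==> accepting q.2
  | fAll _ f => fun Q => [forall q in Q, accepting q]
  | fEx _ f => fun Q => [exists q in Q, accepting q]
  end.

(** * The state reached on a cut of the atoms *)

Section Types.
Variable M : structure.
Hypothesis M_models : models M T_MSO_Fin.
Implicit Types (A B : M) (a x y : M) (C D : M -> Prop) (e : nat -> M).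

(* As no atom lies below the bottom element, [meets_diff C e s tBot] says that
   [s] contains an atom of [C]. *)
Definition meets_diff C e s t :=
  exists x, [/\ iat x, C x, isub x (eval e s) & ~ isub x (eval e t)].

Definition meets_lt C e s t :=
  exists x y, [/\ iat x /\ C x, iat y /\ C y, isub x (eval e s),
                  isub y (eval e t) & ilhd x y].

(* [typed C e q]: the automaton of [f] is in state [q] after reading [C]. *)
Fixpoint typed (f : formula) C e : state f -> Prop :=
  match f with
  | fFalse => fun=> True
  | fSub s t => fun q => q <-> meets_diff C e s t
  | fEq s t => fun q =>
      (q.1 <-> meets_diff C e s t) /\ (q.2 <-> meets_diff C e t s)
  | fLhd s t => fun q =>
      (q.1 <-> meets_diff C e s tBot) /\ (q.2 <-> meets_lt C e s t)
  | fAt t => fun q =>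
      (q.1 <-> meets_diff C e t tBot) /\ (q.2 <-> meets_lt C e t t)
  | fAnd f g | fOr f g | fImp f g => fun q => typed C e q.1 /\ typed C e q.2
  | fAll v f | fEx v f => fun Q =>
      forall q, q \in Q <-> exists A, typed C (upd e v A) q
  end.

Lemma decide (p : Prop) : exists b : bool, b <-> p.
Proof. by case: (classic p) => H; [exists true | exists false]; split. Qed.

Lemma iff_bool_inj (p : Prop) (b c : bool) : (b <-> p) -> (c <-> p) -> b = c.
Proof. by move=> H K; apply/idP/idP => [/H/K|/K/H]. Qed.

(** Together with [typed_inj] this makes the state a function of the cut and the assignment. For a
    quantifier, the membership of each of the finitely many states is decided classically. *)
Lemma typed_total f C e : exists q : state f, typed C e q.
Proof.
elim: f e => [s t|s t|s t|t||f IHf g IHg|f IHf g IHg|f IHf g IHg|v f IHf|v f IHf] e /=.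
- have [b Hb] := decide (meets_diff C e s t).
  by have [c Hc] := decide (meets_diff C e t s); exists (b, c).
- exact: decide.
- have [b Hb] := decide (meets_diff C e s tBot).
  by have [c Hc] := decide (meets_lt C e s t); exists (b, c).
- have [b Hb] := decide (meets_diff C e t tBot).
  by have [c Hc] := decide (meets_lt C e t t); exists (b, c).
- by exists tt.
1-3: by have [p Hp] := IHf e; have [q Hq] := IHg e; exists (p, q).
all: have [P HP] := fin_all_exists
  (fun q => decide (exists A, typed (f := f) C (upd e v A) q)).
all: by exists [set q | P q] => q; rewrite inE; apply: HP.
Qed.

Lemma typed_inj f C e (p q : state f) : typed C e p -> typed C e q -> p = q.
Proof.
elim: f p q => [s t|s t|s t|t||f IHf g IHg|f IHf g IHg|f IHf g IHg|v f IHf|v f IHf] /=.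
1,3,4: by move=> [p1 p2] [q1 q2] /= [H1 H2] [K1 K2]; congr pair;
  apply: iff_bool_inj; eassumption.
- by move=> p q; apply: iff_bool_inj.
- by case; case.
1-3: by move=> [p1 p2] [q1 q2] /= [H1 H2] [K1 K2]; congr pair; auto.
all: by move=> P Q H K; apply/setP => q; apply: (iff_bool_inj (H q) (K q)).
Qed.

Definition agree_on (vs : seq nat) C e e' :=
  forall x v, v \in vs -> iat x -> C x -> isub x (e v) <-> isub x (e' v).

Lemma agree_on_eval vs C e e' t x :
  agree_on vs C e e' -> {subset fv_term t <= vs} -> iat x -> C x ->
  isub x (eval e t) <-> isub x (eval e' t).
Proof.
by move=> H; case: t => //= v K; apply: H; apply: K; rewrite inE.
Qed.

Lemma agree_on_sub vs ws C e e' :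
  {subset ws <= vs} -> agree_on vs C e e' -> agree_on ws C e e'.
Proof. by move=> K H x v /K; apply: H. Qed.

Lemma agree_on_upd vs C e e' v A B :
  agree_on [seq w <- vs | w != v] C e e' ->
  (forall x, iat x -> C x -> isub x A <-> isub x B) ->
  agree_on vs C (upd e v A) (upd e' v B).
Proof.
move=> H K x w wvs xA Cx; rewrite /upd; case: eqVneq => [_|wv]; first exact: K.
by apply: H; rewrite // mem_filter wv.
Qed.

(** * Dependence of the state on the traces alone *)

Section Locality.
Variables (C D : M -> Prop).
Hypothesis CD : forall x, iat x -> C x <-> D x.

Lemma meets_diff_local e e' s t :
  agree_on (fv_term s ++ fv_term t) C e e' ->
  meets_diff C e s t <-> meets_diff D e' s t.
Proof.
move=> H.
have Hs x := agree_on_eval (t := s) (x := x) H (mem_subseq (prefix_subseq _ _)).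
have Ht x := agree_on_eval (t := t) (x := x) H (mem_subseq (suffix_subseq _ _)).
split=> -[x [xA Cx xs xt]]; exists x.
  by split=> //; [apply/CD | apply/Hs | move/(Ht x xA Cx)].
move/(CD xA): Cx => Cx.
by split=> //; [apply/Hs | move/(Ht x xA Cx)].
Qed.

Lemma meets_lt_local e e' s t :
  agree_on (fv_term s ++ fv_term t) C e e' ->
  meets_lt C e s t <-> meets_lt D e' s t.
Proof.
move=> H.
have Hs x := agree_on_eval (t := s) (x := x) H (mem_subseq (prefix_subseq _ _)).
have Ht x := agree_on_eval (t := t) (x := x) H (mem_subseq (suffix_subseq _ _)).
split=> -[x [y [[xA Cx] [yA Cy] xs yt xy]]]; exists x, y.
  by split=> //; [split=> //; apply/CD | split=> //; apply/CD | apply/Hs | apply/Ht].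
move/(CD xA): Cx => Cx; move/(CD yA): Cy => Cy.
by split=> //; [apply/Hs | apply/Ht].
Qed.

(** Cuts are predicates, so agreement on atoms stands in for their equality. Under a quantifier the
    same witness [A] works on both sides. *)
Lemma typed_local f e e' (q : state f) :
  agree_on (fv f) C e e' -> typed C e q <-> typed D e' q.
Proof.
elim: f q e e' => [s t|s t|s t|t||f IHf g IHg|f IHf g IHg|f IHf g IHg|v f IHf|v f IHf]
  q e e' H /=.
- rewrite (meets_diff_local H) (@meets_diff_local _ e') //.
  by apply: agree_on_sub H => w; rewrite !mem_cat orbC.
- by rewrite (meets_diff_local H).
- rewrite (meets_lt_local H) (@meets_diff_local _ e') //.
  by apply: agree_on_sub H => w; rewrite !mem_cat orbF => ->.
- rewrite (@meets_diff_local _ e') ?(@meets_lt_local _ e') //.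
    by apply: agree_on_sub H => w; rewrite !mem_cat orbb.
  by apply: agree_on_sub H => w; rewrite !mem_cat orbF.
- by [].
1-3: have Hf : agree_on (fv f) C e e'
  by apply: agree_on_sub H => w wf; rewrite /= mem_cat wf.
1-3: have Hg : agree_on (fv g) C e e'
  by apply: agree_on_sub H => w wf; rewrite /= mem_cat wf orbT.
1-3: by rewrite (IHf _ _ _ Hf) (IHg _ _ _ Hg).
all: have Hv A (p : state f) : typed C (upd e v A) p <-> typed D (upd e' v A) p
  by apply: IHf; apply: agree_on_upd.
all: by split=> K p; rewrite (K p); split=> -[A /Hv]; exists A.
Qed.

End Locality.

(** On the empty cut the state does not depend on the assignment, so varying the quantified set
    yields a single state. *)
Lemma typed_init f e : typed (fun=> False) e (init f).
Proof.
have nd s t e' : false <-> meets_diff (fun=> False) e' s t.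
  by split=> // -[x []].
have nl s t e' : false <-> meets_lt (fun=> False) e' s t.
  by split=> // -[x [y [[]]]].
elim: f e => [s t|s t|s t|t||f IHf g IHg|f IHf g IHg|f IHf g IHg|v f IHf|v f IHf] e //=.
all: move=> q; rewrite inE; split=> [/eqP->|[A qA]]; last exact/eqP/(typed_inj qA).
all: by exists (ibot M).
Qed.

Lemma letterE (l : nat -> bool) e a t : iat a -> (forall v, l v <-> isub a (e v)) ->
  letter l t <-> isub a (eval e t).
Proof.
by move=> aA H; case: t => //=; split=> // /(atom_not_sub_bot M_models aA).
Qed.

(** * Adding one atom on top of a cut *)

Section Step.
Variables (C : M -> Prop) (a : M).
Hypothesis aA : iat a.
Hypothesis Ca : forall x, iat x -> C x -> ilhd x a.
Let D x := C x \/ x = a.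

Lemma step_diffP (l : nat -> bool) e s t (b : bool) :
  (forall v, l v <-> isub a (e v)) ->
  (b <-> meets_diff C e s t) -> (step_diff l s t b <-> meets_diff D e s t).
Proof.
move=> Hl Hb; have [Ls Lt] := (letterE s aA Hl, letterE t aA Hl).
rewrite /step_diff; split=> [/orP[/Hb[x [xA Cx xs xt]]|/andP[/Ls xs /negP xt]]|].
- by exists x; split=> //; left.
- by exists a; split=> //; [right | move/Lt/xt].
move=> [x [xA [Cx|xa] xs xt]].
  by rewrite (_ : b) //; apply/Hb; exists x.
move: xs xt; rewrite xa => /Ls-> xt; apply/orP; right.
by apply/negP => /Lt.
Qed.

Lemma step_ltP (l : nat -> bool) e s t (b c : bool) :
  (forall v, l v <-> isub a (e v)) ->
  (b <-> meets_diff C e s tBot) -> (c <-> meets_lt C e s t) ->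
  (step_lt l t b c <-> meets_lt D e s t).
Proof.
move=> Hl Hb Hc; have Lt := letterE t aA Hl.
rewrite /step_lt; split.
  move=> /orP[/Hc[x [y [[xA Cx] [yA Cy] xs yt xy]]]|].
    by exists x, y; split=> //; split=> //; left.
  move=> /andP[/Hb[x [xA Cx xs _]] /Lt xt].
  exists x, a; split=> //; [by split=> //; left|by split=> //; right|].
  exact: Ca.
(* Nothing in the enlarged cut lies above [a], so an increasing pair is either inside [C] or has [y]
   equal to [a]. *)
move=> [x [y [[xA [Cx|xa]] [yA [Cy|ya]] xs yt xy]]].
- by rewrite (_ : c) //; apply/Hc; exists x, y.
- apply/orP; right; apply/andP; split; last by apply/Lt; rewrite -ya.
  by apply/Hb; exists x; split=> //; apply: (atom_not_sub_bot M_models).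
- rewrite xa in xy; case: (ilhd_irrefl M_models aA).
  exact: (ilhd_trans M_models) xy (Ca yA Cy).
- by rewrite xa ya in xy; case: (ilhd_irrefl M_models aA).
Qed.

Lemma typed_step (l : nat -> bool) f e (q : state f) :
  (forall v, l v <-> isub a (e v)) -> typed C e q -> typed D e (step l q).
Proof.
elim: f q l e => [s t|s t|s t|t||f IHf g IHg|f IHf g IHg|f IHf g IHg|v f IHf|v f IHf]
  q l e Hl /=.
- by move=> [H K]; split; apply: step_diffP.
- exact: step_diffP.
- by move=> [H K]; split; [apply: step_diffP | apply: step_ltP].
- by move=> [H K]; split; [apply: step_diffP | apply: step_ltP].
- by [].
1-3: by move=> [H K]; split; auto.
all: move=> H p; rewrite inE.
all: have Hu A (b : bool) : (b <-> isub a A) ->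
    forall w, upd l v b w <-> isub a (upd e v A w)
  by move=> Hb w; rewrite /upd; case: ifP.
all: split=> [/existsP[r /andP[/H[A rA] /existsP[b /eqP->]]]|[A pA]].
(* The bit [b] need not be that of [A] at [a]. Altering [A] there keeps its trace on [C], and hence
   the state [r]. *)
1,3: have [B [aB AB]] := insert_atom M_models A b aA.
1,2: exists B; apply: IHf; first exact: Hu.
1,2: apply/(typed_local (C := C) _ _ (e := upd e v A)) => //; apply: agree_on_upd => //.
1,2: move=> x xA Cx; apply: iff_sym; apply: AB => // xa.
1,2: by rewrite xa in Cx; apply: (ilhd_irrefl M_models aA); apply: Ca.
(* Conversely, the state of [A] on [C] and the bit of [A] at [a] lead to a state of [A] on the
   larger cut, which is [p] by uniqueness. *)
all: have [r rA] := typed_total f C (upd e v A).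
all: have [b aAb] := decide (isub a A).
all: apply/existsP; exists r; apply/andP; split; first by apply/H; exists A.
all: apply/existsP; exists b; apply/eqP; apply: typed_inj pA _.
all: by apply: IHf => //; apply: Hu.
Qed.

End Step.

(** Once all atoms are read, inclusion is the absence of an atom in the difference, by [isub_atoms];
    [ilhd_sets] and [iat_unique] treat [fLhd] and [fAt]. For quantifiers, every set [A] contributes
    a state by [typed_total]. *)
Lemma typed_accepting f e (q : state f) :
  typed (@iat M) e q -> sat e f <-> accepting q.
Proof.
have nmd s t e' (b : bool) : (b <-> meets_diff (@iat M) e' s t) ->
    (~~ b <-> isub (eval e' s) (eval e' t)).
  move=> Hb; split=> [/negP nb|H].
    apply: (isub_atoms M_models) => a aA aS; apply: NNPP => aT.
    by apply: nb; apply/Hb; exists a.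
  apply/negP => /Hb[x [xA _ xs xt]]; apply: xt.
  exact: (isub_trans M_models) H.
elim: f q e => [s t|s t|s t|t||f IHf g IHg|f IHf g IHg|f IHf g IHg|v f IHf|v f IHf]
  q e /=.
- move=> [/nmd H /nmd K]; split=> [E|/andP[/H ST /K TS]].
    by apply/andP; split; [apply/H | apply/K]; rewrite E; apply: isubxx.
  exact: isub_antisym.
- by move=> /nmd H; rewrite H.
- move=> [_ H]; rewrite H (ilhd_sets M_models).
  split=> [[a [b [? ? ? ? ?]]]|[a [b [[? _] [? _] ? ? ?]]]]; first by exists a, b.
  by exists a, b.
- move=> [H K]; rewrite (iat_unique M_models).
  split=> [[[a aA aT] nlt]|/andP[/H[a [aA _ aT _]] /negP nlt]].
    apply/andP; split.
      by apply/H; exists a; split=> //; apply: (atom_not_sub_bot M_models).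
    apply/negP => /K[x [y [[xA _] [yA _] ? ? ?]]].
    by apply: nlt; exists x, y.
  split; first by exists a.
  by move=> [x [y [? ? ? ? ?]]]; apply: nlt; apply/K; exists x, y.
- by [].
1-3: move=> [/IHf-> /IHg->].
- by split=> /andP.
- by split=> /orP.
- by split=> /implyP.
- move=> H; split=> [K|/forall_inP K A].
    by apply/forall_inP => p /H[A /IHf<-]; apply: K.
  have [p pA] := typed_total f (@iat M) (upd e v A).
  by apply/(IHf p) => //; apply: K; apply/H; exists A.
- move=> H; split=> [[A K]|/exists_inP[p /H[A /IHf pA] K]].
    have [p pA] := typed_total f (@iat M) (upd e v A).
    by apply/exists_inP; exists p; [apply/H; exists A | rewrite -(IHf _ _ pA)].
  by exists A; apply/pA.
Qed.

(** Exceeds every variable of [f], bound ones included: the variable [u] naming the endpoint of a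
    cut must not be overwritten by a quantifier. *)
Fixpoint bound (f : formula) : nat :=
  match f with
  | fEq s t | fSub s t | fLhd s t => maxn (fresh [:: s]) (fresh [:: t])
  | fAt t => fresh [:: t]
  | fFalse => 0
  | fAnd f g | fOr f g | fImp f g => maxn (bound f) (bound g)
  | fAll v f | fEx v f => maxn v.+1 (bound f)
  end.

Lemma eval_upd e v A t : fresh [:: t] <= v -> eval (upd e v A) t = eval e t.
Proof. by case: t => //= w; rewrite maxn0 /upd => /ltn_eqF ->. Qed.

Lemma meets_diff_definable u s t : fresh [:: s] <= u -> fresh [:: t] <= u ->
  definable (fun e : nat -> M => meets_diff (fun x => ileq x (e u)) e s t).
Proof.
move=> su tu.
exists (fEx u.+1 (fAnd (fAt u.+1) (fAnd (fOr (fEq u.+1 u) (fLhd u.+1 u))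
         (fAnd (fSub u.+1 s) (fImp (fSub u.+1 t) fFalse))))) => e /=.
have E x : (upd e u.+1 x u.+1 = x) * (upd e u.+1 x u = e u).
  by rewrite /upd eqxx ltn_eqF.
have V x := (eval_upd e x (leqW su), eval_upd e x (leqW tu)).
split=> -[x H]; exists x; move: H; rewrite !E !V; first by case=> ? [? [? ?]].
by case.
Qed.

Lemma meets_lt_definable u s t : fresh [:: s] <= u -> fresh [:: t] <= u ->
  definable (fun e : nat -> M => meets_lt (fun x => ileq x (e u)) e s t).
Proof.
move=> su tu; pose le v := fAnd (fAt (Var v)) (fOr (fEq v u) (fLhd v u)).
exists (fEx u.+1 (fEx u.+2 (fAnd (le u.+1) (fAnd (le u.+2)
         (fAnd (fSub u.+1 s) (fAnd (fSub u.+2 t) (fLhd u.+1 u.+2))))))) => e /=.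
have E x y : (upd (upd e u.+1 x) u.+2 y u.+1 = x) *
    (upd (upd e u.+1 x) u.+2 y u.+2 = y) * (upd (upd e u.+1 x) u.+2 y u = e u).
  by rewrite /upd !eqxx !ltn_eqF.
have V x y : (eval (upd (upd e u.+1 x) u.+2 y) s = eval e s) *
    (eval (upd (upd e u.+1 x) u.+2 y) t = eval e t).
  by rewrite !eval_upd // ?leqW // ?leqW.
split=> -[x [y H]]; exists x, y; move: H; rewrite !E !V.
  by case=> ? [? [? [? ?]]].
by case.
Qed.

(** There are finitely many states, so the condition for a quantifier is a finite conjunction over
    the states [p]. This opens comprehension and atom induction to statements about states. *)
Lemma typed_definable f u (q : state f) : bound f <= u ->
  definable (fun e : nat -> M => typed (fun x => ileq x (e u)) e q).
Proof.
elim: f q => [s t|s t|s t|t||f IHf g IHg|f IHf g IHg|f IHf g IHg|v f IHf|v f IHf] q /=.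
1-3: rewrite geq_max => /andP[su tu].
- by apply: definable_and; apply: definable_iff; apply: meets_diff_definable.
- by apply: definable_iff; apply: meets_diff_definable.
- apply: definable_and; apply: definable_iff; last exact: meets_lt_definable.
  exact: meets_diff_definable.
- move=> tu; apply: definable_and; apply: definable_iff; last exact: meets_lt_definable.
  exact: meets_diff_definable.
- by move=> _; apply: definable_const.
1-3: by rewrite geq_max => /andP[fu gu]; apply: definable_and; auto.
all: rewrite geq_max => /andP[vu fu].
all: apply: definable_ext (definable_all_in (enum (state f)) (fun p =>
  definable_iff (p \in q) (definable_ex v (IHf p fu)))) => e.
all: have E A : upd e v A u = e u by rewrite /upd gtn_eqF.
all: have K p : (exists A, typed (fun x => ileq x (upd e v A u)) (upd e v A) p) <->
    exists A, typed (f := f) (fun x => ileq x (e u)) (upd e v A) p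
  by split=> -[A H]; exists A; move: H; rewrite E.
all: split=> [H p|H p _]; last exact: iff_trans (H p) (iff_sym (K p)).
all: by apply: iff_trans (K p); apply: (H p); rewrite mem_enum.
Qed.

End Types.

(** * Initial segments and the sentences psi and rho *)

Section Segments.
Variable M : structure.
Hypothesis M_models : models M T_MSO_Fin.
Implicit Types (a b x y z : M) (e g : nat -> M).

(** The values of [g] below [n] list the first [n] atoms in order; its other values are
    arbitrary. *)
Definition initseg n g :=
  [/\ forall i, i < n -> iat (g i),
      forall i j, i < j < n -> ilhd (g i) (g j) &
      forall x, iat x ->
        (exists2 i, i < n & x = g i) \/ (forall i, i < n -> ilhd (g i) x)].

Lemma initseg_leq m n g : m <= n -> initseg n g -> initseg m g.
Proof.
move=> mn [gA glt gx]; split=> [i im|i j /andP[ij jm]|x xA].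
- exact: gA (leq_trans im mn).
- by apply: glt; rewrite ij (leq_trans jm).
case: (gx x xA) => [[i ni ->]|H]; last by right=> i im; apply: H (leq_trans im mn).
case: (ltnP i m) => im; first by left; exists i.
by right=> j jm; apply: glt; rewrite (leq_trans jm).
Qed.

Definition covers n g := forall x : M, iat x -> exists2 i, i < n & x = g i.

Lemma leq_covered m n g (h : nat -> M) :
  (forall i j, i < j < m -> h i <> h j) ->
  (forall i, i < m -> exists2 j, j < n & h i = g j) -> m <= n.
Proof.
move=> hinj H.
have ex (i : 'I_m) : exists j : 'I_n, h i = g j.
  by have [j jn E] := H i (ltn_ord i); exists (Ordinal jn).
have [f Hf] := fin_all_exists ex.
suff finj : injective f by have := leq_card f finj; rewrite !card_ord.
move=> i j fij; apply: val_inj => /=.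
have E : h i = h j by rewrite !Hf fij.
case: (ltngtP i j) => // ij; first by case: (hinj i j); rewrite ?ij /=.
by case: (hinj j i); rewrite ?ij /=.
Qed.

Lemma initseg_neq n g i j : initseg n g -> i < j < n -> g i <> g j.
Proof.
move=> [gA glt _] ij E; have /andP[_ jn] := ij.
by apply: (ilhd_irrefl M_models (gA j jn)); rewrite -{1}E; apply: glt.
Qed.

(** A least atom outside the list of the first [n] extends the list; if no atom is outside, the list
    is complete. *)
Lemma initseg_or_covers n :
  (exists g, initseg n g) \/
  (exists2 j, j < n & exists2 g, initseg j g & covers j g).
Proof.
elim: n => [|n [[g gn]|[j jn H]]].
- left; exists (fun=> ibot M); split=> // [i j|x xA]; first by rewrite andbF.
  by right.
- have [gA glt gx] := gn.
  (* The variables below [n] hold the listed atoms as parameters; [n] is the variable of the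
     comprehension. *)
  pose P (e : nat -> M) := {in iota 0 n, forall i, e n = e i -> False}.
  have dP : definable P.
    apply: definable_all_in => i; apply: definable_imp (definable_const _ _).
    by exists (fEq n i).
  have [X HX] := comprehension M_models g n dP.
  have {}HX x : iat x -> isub x X <-> forall i, i < n -> x <> g i.
    move=> xA; apply: (iff_trans (HX x xA)); rewrite /P /upd eqxx.
    split=> H i; first by move=> ni; have := H i; rewrite mem_iota ltn_eqF //; apply.
    by rewrite mem_iota => /= ni; rewrite ltn_eqF //; apply: H.
  case: (classic (X = ibot M)) => [X0|/(exists_least_in M_models)].
    right; exists n => //; exists g => // x xA; apply: NNPP => H.
    apply: (atom_not_sub_bot M_models xA); rewrite -X0; apply/HX => // i ni xi.
    by apply: H; exists i.
  move=> [b [bA /(HX _ bA) bg bmin]].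
  have gb i : i < n -> ilhd (g i) b.
    by case: (gx b bA) => [[j jn /bg]|] //; apply.
  left; exists (upd g n b); rewrite /upd; split.
  + by move=> i; rewrite ltnS leq_eqVlt; case: eqP => //= _ /gA.
  + move=> i j /andP[ij]; rewrite ltnS leq_eqVlt; case: eqVneq => [E|_] /= jn.
      by rewrite E in ij; rewrite ltn_eqF //; apply: gb.
    by rewrite ltn_eqF ?(ltn_trans ij) //; apply: glt; rewrite ij.
  + move=> x xA; case: (classic (isub x X)) => [xX|].
      case: (bmin x xA xX) => [<-|bx]; first by left; exists n; rewrite ?eqxx.
      right=> i; rewrite ltnS leq_eqVlt; case: eqP => //= _ ni.
      exact: (ilhd_trans M_models (gA i ni) bA xA (gb i ni) bx).
    move=> nX; left; apply: NNPP => H; apply: nX; apply/HX => // i ni xi.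
    by apply: H; exists i; rewrite ?ltn_eqF // leqW.
- by right; exists j; rewrite // leqW.
Qed.

(** The given distinct atoms need not be the first ones, but by counting they exclude that at most
    [n] atoms exhaust the model. *)
Lemma psi_gtP n e : sat e (psi_gt n) -> exists g, initseg n.+1 g.
Proof.
move=> /sat_exs_at[h [_ hA /sat_conj_over hd]].
have [//|[j jn [g _ gc]]] := initseg_or_covers n.+1.
suff : n.+1 <= j by rewrite leqNgt jn.
apply: (@leq_covered _ _ g h) => [i k /andP[ik kn] E|i ni]; last first.
  by apply: gc; apply: hA; rewrite mem_iota.
have /hd/sat_conj_over/(_ i) : k \in iota 0 n.+1 by rewrite mem_iota.
by rewrite mem_iota => /(_ ik) /=; rewrite E; apply.
Qed.

Lemma psi_eqP n e : sat e (psi_eq n) -> exists2 g, initseg n g & covers n g.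
Proof.
move=> /sat_exs_at[h [_ hA [/sat_conj_over hd hc]]].
have {}hc : covers n h.
  move=> x xA; have := hc x; rewrite /= /upd eqxx.
  move=> /(_ xA)/sat_disj_over[i]; rewrite mem_iota /= eqxx => ni.
  by rewrite ltn_eqF // => ->; exists i.
have [[g gn]|[j jn [g gs gc]]] := initseg_or_covers n.+1.
  suff : n.+1 <= n by rewrite ltnn.
  apply: (@leq_covered _ _ h g) => [i k /(initseg_neq gn) //|i ni].
  by apply: hc; case: gn => gA _ _; apply: gA.
suff E : j = n by rewrite -E; exists g.
apply/eqP; rewrite eqn_leq -ltnS jn /=.
apply: (@leq_covered _ _ g h) => [i k /andP[ik kn] E|i ni]; last first.
  by apply: gc; apply: hA; rewrite mem_iota.
have /hd/sat_conj_over/(_ i) : k \in iota 0 n by rewrite mem_iota.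
by rewrite mem_iota => /(_ ik) /=; rewrite E; apply.
Qed.

Lemma sat_distinct n g e : initseg n g -> {in iota 0 n, e =1 g} ->
  sat e (distinct n).
Proof.
move=> gn eg; apply/sat_conj_over => j; rewrite mem_iota => /= jn.
apply/sat_conj_over => i; rewrite mem_iota => /= ij.
rewrite !eg ?mem_iota ?(ltn_trans ij) // => E.
by apply: (initseg_neq gn (i := i) (j := j)); rewrite ?ij.
Qed.

Lemma initseg_psi_gt n g e : initseg n.+1 g -> sat e (psi_gt n).
Proof.
move=> gn; apply/sat_exs_at.
exists (fun w => if w \in iota 0 n.+1 then g w else e w); split.
- by move=> w /negPf ->.
- by move=> w wn; rewrite wn; case: gn => gA _ _; apply: gA; rewrite mem_iota in wn.
- by apply: sat_distinct gn _ => w ->.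
Qed.

Lemma covers_psi_eq n g e : initseg n g -> covers n g -> sat e (psi_eq n).
Proof.
move=> gn gc; apply/sat_exs_at.
exists (fun w => if w \in iota 0 n then g w else e w); split.
- by move=> w /negPf ->.
- by move=> w wn; rewrite wn; case: gn => gA _ _; apply: gA; rewrite mem_iota in wn.
split; first by apply: sat_distinct gn _ => w ->.
move=> x; rewrite /= /upd eqxx => xA; apply/sat_disj_over.
have [i ni ->] := gc x xA; exists i; first by rewrite mem_iota.
by rewrite /= eqxx ltn_eqF // mem_iota ni.
Qed.

Definition residue_sets (d h : nat) (B : nat -> M) :=
  [/\ forall i, 0 < i <= d -> B i <> ibot M,
      forall a, iat a -> exists2 i, 0 < i <= d & isub a (B i),
      forall a, iat a -> forall i j, 0 < j < i -> i <= d ->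
        ~ (isub a (B i) /\ isub a (B j)),
      exists2 a, least_atom a & isub a (B 1) &
      (forall a b, succ_atom a b -> forall i, 0 < i <= d -> isub a (B i) ->
        isub b (B (if i < d then i.+1 else 1))) /\
      (exists2 a, greatest_atom a & isub a (B h))].

(** In [rho] atoms are quantified through the variables 0 and 1, while the sets sit at [i.+1] with
    [i] at least 1, so the two ranges are disjoint. *)
Lemma sat_rho d h e : 0 < h <= d ->
  sat e (rho d h) <-> exists B, residue_sets d h B.
Proof.
move=> /andP[h0 hd].
have iotaE i : (i \in iota 1 d) = (0 < i <= d) by rewrite mem_iota add1n ltnS.
have upd0 (e' : nat -> M) a i : upd e' 0 a i.+1 = e' i.+1 by [].
have upd01 (e' : nat -> M) a b i : 0 < i -> upd (upd e' 0 a) 1 b i.+1 = e' i.+1.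
  by case: i.
rewrite /rho; set f := fAnd _ _.
have body e' : sat e' f <-> residue_sets d h (fun i => e' i.+1).
  split.
    move=> [/sat_conj_over H1 [H2 [H3 [[a [aA [a0 a1]]] [H5 [b [bA [b0 bh]]]]]]]].
    split.
    - by move=> i; rewrite -iotaE => /H1.
    - move=> x xA; have /sat_disj_over[i] := H2 x xA.
      by rewrite iotaE /= upd0; exists i.
    - move=> x xA i j /andP[j0 ji] id [xi xj].
      have /sat_conj_over/(_ i) := H3 x xA.
      rewrite iotaE id (leq_trans _ ji) // => /(_ isT)/sat_conj_over/(_ j).
      rewrite mem_iota add1n prednK ?j0 ?ji ?(leq_trans _ ji) //.
      by move=> /(_ isT); apply.
    - by exists a => //; apply/(least_atomE (upd e' 0 a) 0).
    split; last by exists b => //; apply/(greatest_atomE (upd e' 0 b) 0).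
    move=> x y xy i id xi; have [xA yA lxy _] := xy.
    have /sat_conj_over/(_ i) : sat (upd (upd e' 0 x) 1 y) (conj_over (iota 1 d)
        (fun i => fImp (fSub 0 i.+1) (fSub 1 (if i < d then i.+1 else 1).+1))).
      apply: (H5 x xA _ y yA); last exact/(succ_atomE (upd (upd e' 0 x) 1 y) 0 1).
      (* [x] is not greatest because its successor [y] lies above it. *)
      move=> /(greatest_atomE (upd e' 0 x) 0)[_ /(_ y yA)].
      rewrite {1}/upd /=; case=> yx.
        by apply: (ilhd_irrefl M_models xA); rewrite yx in lxy.
      exact: (ilhd_irrefl M_models xA (ilhd_trans M_models xA yA xA lxy yx)).
    rewrite iotaE id => /(_ isT); have /andP[i0 _] := id.
    have j0 : 0 < (if i < d then i.+1 else 1) by case: ifP.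
    by rewrite /= (upd01 _ _ _ i) // (upd01 _ _ _ _ j0); apply.
  move=> [H1 H2 H3 [a a0 a1] [H5 [b b0 bh]]].
  split; first by apply/sat_conj_over => i; rewrite iotaE => /H1.
  split.
    move=> x xA; apply/sat_disj_over; have [i id xi] := H2 x xA.
    by exists i; rewrite ?iotaE.
  split.
    move=> x xA; apply/sat_conj_over => i; rewrite iotaE => /andP[i0 id].
    apply/sat_conj_over => j; rewrite mem_iota add1n prednK // => ji.
    exact: (H3 x xA i j).
  split.
    exists a; split; first by case: a0.
    by split=> //; apply/(least_atomE (upd e' 0 a) 0).
  split; last first.
    exists b; split; first by case: b0.
    by split=> //; apply/(greatest_atomE (upd e' 0 b) 0).
  move=> x xA _ y yA /(succ_atomE (upd (upd e' 0 x) 1 y) 0 1) xy.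
  apply/sat_conj_over => i; rewrite iotaE => id; have /andP[i0 _] := id.
  have j0 : 0 < (if i < d then i.+1 else 1) by case: ifP.
  by move: (H5 x y xy i id); rewrite /= (upd01 _ _ _ i) // (upd01 _ _ _ _ j0).
apply: (iff_trans (sat_exs _ _ _)); split=> [[e' [_ /body]]|[B HB]].
  by exists (fun i => e' i.+1).
exists (fun w => if w \in [seq i.+1 | i <- iota 1 d] then B w.-1 else e w).
split; first by move=> w /negPf ->.
apply/body.
have E i : 0 < i <= d ->
    (if i.+1 \in [seq i.+1 | i <- iota 1 d] then B i.+1.-1 else e i.+1) = B i.
  by move=> id; rewrite (mem_map succn_inj) iotaE id.
have d0 : 0 < d by apply: leq_trans hd.
case: HB => [H1 H2 H3 [a a0 a1] [H5 [b b0 bh]]]; split.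
- by move=> i id; rewrite E //; apply: H1.
- by move=> x xA; have [i id xi] := H2 x xA; exists i; rewrite ?E.
- move=> x xA i j ji id; have /andP[j0 lji] := ji.
  rewrite !E ?id ?j0 ?(leq_trans _ lji) ?(ltnW (leq_trans lji id)) //.
  exact: H3.
- by exists a; rewrite ?E.
split; last by exists b; rewrite ?E ?h0.
move=> x y xy i id; rewrite !E //; first exact: H5.
by case: ifP => //; rewrite d0.
Qed.

End Segments.

(** * The lasso of a sentence *)

(** [n1] is the size of the orbit: the first [n1] iterates are distinct, and the next one repeats
    the one of index [n0]. *)
Lemma eventually_periodic (T : finType) (F : T -> T) (x : T) :
  exists n0 n1, [/\ n0 < n1, iter n1 F x = iter n0 F x &
    forall i j, i < n1 -> j < n1 -> iter i F x = iter j F x -> i = j].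
Proof.
have /trajectP[n0 lt0 E] := looping_order F x.
exists n0, (fingraph.order F x); split=> // i j li lj.
rewrite -!(nth_traject F li) -!(nth_traject F lj) => /eqP.
by rewrite nth_uniq ?size_traject ?(orbit_uniq F x) // => /eqP.
Qed.

Section Sentence.
Variables (M : structure) (phi : formula).
Hypotheses (M_models : models M T_MSO_Fin) (phi_sentence : sentence phi).
Implicit Types (a b x y z : M) (e g : nat -> M) (q : state phi).

Let bot : nat -> M := fun=> ibot M.
Let F : state phi -> state phi := step (fun=> false).
(** The cut up to an atom contains that atom, so the least atom already carries one application of
    [F]. With this shift the atom of rank [n], counted from 0, has state [iter n F q0]. *)
Let q0 := F (init phi).

Definition type_upto z q := typed (fun x => ileq x z) bot q.

(** Without free variables, [typed_local] puts no condition on the assignments. *)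
Lemma typed_sentence (C D : M -> Prop) e e' q :
  (forall x, iat x -> C x <-> D x) -> typed C e q -> typed D e' q.
Proof.
move=> CD; apply: (typed_local CD _ _).1.
by rewrite phi_sentence => x v.
Qed.

Lemma typed_step0 (C : M -> Prop) a q :
  iat a -> (forall x, iat x -> C x -> ilhd x a) -> typed C bot q ->
  typed (fun x => C x \/ x = a) bot (F q).
Proof.
move=> aA Ca; apply: typed_step => // v; split=> //.
by move/(atom_not_sub_bot M_models aA).
Qed.

Lemma typed_initseg n g : initseg n g ->
  typed (fun x => exists2 i, i < n & x = g i) bot (iter n F (init phi)).
Proof.
elim: n => [|n IH] gn.
  by apply: typed_sentence (typed_init phi bot) => x xA; split=> // -[].
have [gA glt gx] := gn.
have {}IH := IH (initseg_leq (leqnSn n) gn).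
apply: typed_sentence (typed_step0 (gA n (ltnSn n)) _ IH) => x xA.
  split=> [[[i ni ->]|->]|[i]]; [by exists i; rewrite // leqW | by exists n |].
  rewrite ltnS leq_eqVlt => /orP[/eqP-> ->|ni ->]; first by right.
  by left; exists i.
by move=> [i ni ->]; apply: glt; rewrite ni /=.
Qed.

Lemma type_nth n g : initseg n.+1 g -> type_upto (g n) (iter n F q0).
Proof.
move=> gn; have [gA glt gx] := gn.
have gnA := gA n (ltnSn n).
rewrite /q0 -iterSr; apply: typed_sentence (typed_initseg gn) => x xA.
split=> [[i]|H].
  rewrite ltnS leq_eqVlt => /orP[/eqP-> ->|ni ->]; first by left.
  by right; apply: glt; rewrite ni /=.
case: (gx x xA) => [//|/(_ n (ltnSn n)) nx]; case: H => [E|xn].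
  by case: (ilhd_irrefl M_models xA); rewrite {1}E.
by case: (ilhd_irrefl M_models xA (ilhd_trans M_models xA gnA xA xn nx)).
Qed.

Lemma type_least a : least_atom a -> type_upto a q0.
Proof.
move=> [aA amin]; apply: (@type_nth 0 (fun=> a)); split=> // [i j|x xA].
  by rewrite ltnS leqn0 => /andP[ij /eqP jE]; rewrite jE in ij.
by case: (amin x xA) => [<-|ax]; [left; exists 0 | right].
Qed.

Lemma type_succ a b q : succ_atom a b -> type_upto a q -> type_upto b (F q).
Proof.
move=> [aA bA ab nab] aq.
apply: typed_sentence (typed_step0 bA _ aq) => x xA; last first.
  by move=> [->|xa] //; apply: (ilhd_trans M_models xA aA bA xa ab).
split=> [[[->|xa]|->]|[->|xb]]; [by right | right | by left | by right | left].
  exact: (ilhd_trans M_models xA aA bA xa ab).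
case: (ilhd_total M_models xA aA) => [xa|->|ax]; [by right | by left |].
by case: nab; exists x.
Qed.

Lemma type_greatest z q e : greatest_atom z -> type_upto z q ->
  sat e phi <-> accepting q.
Proof.
move=> [zA zmax] zq; apply: (typed_accepting M_models (e := e)).
by apply: typed_sentence zq => x xA; split=> // _; apply: zmax.
Qed.

Lemma accepting_covers n g e : initseg n g -> covers n g ->
  sat e phi <-> accepting (iter n F (init phi)).
Proof.
move=> gn gc; apply: (typed_accepting M_models (e := e)).
by apply: typed_sentence (typed_initseg gn) => x xA; split=> // _; apply: gc.
Qed.

(** * Indices of atoms on the lasso *)

Section Lasso.
Variables n0 n1 : nat.
Hypothesis lt01 : n0 < n1.
Hypothesis loop : iter n1 F q0 = iter n0 F q0.
Hypothesis orbit_inj :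
  forall i j, i < n1 -> j < n1 -> iter i F q0 = iter j F q0 -> i = j.

(** Successor along the lasso; past the end it returns to the entry of the loop. *)
Let next m := if m.+1 == n1 then n0 else m.+1.

Lemma next_lt m : m < n1 -> next m < n1.
Proof. by rewrite /next => lm; case: eqVneq => // ne; rewrite ltn_neqAle ne. Qed.

Lemma iter_next m : iter (next m) F q0 = F (iter m F q0).
Proof. by rewrite /next; case: eqP => // E; rewrite -loop -E. Qed.

(** Uniqueness of the index of an atom; the disjointness of the residue classes rests on it. *)
Lemma type_upto_inj z m n : m < n1 -> n < n1 ->
  type_upto z (iter m F q0) -> type_upto z (iter n F q0) -> m = n.
Proof. by move=> lm ln zm zn; apply: orbit_inj => //; apply: typed_inj zm zn. Qed.

(** Atom induction for a disjunction over the indices [m], definable because it is finite. Each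
    disjunct carries along a property [Q m], whose parameters are stored in [e]. *)
Lemma lasso_induction (u := bound phi) e (Q : nat -> (nat -> M) -> Prop) :
  (forall m, definable (Q m)) ->
  (forall a, least_atom a -> Q 0 (upd e u a)) ->
  (forall a b m, m < n1 -> succ_atom a b -> type_upto b (iter (next m) F q0) ->
     Q m (upd e u a) -> Q (next m) (upd e u b)) ->
  forall a, iat a -> exists2 m, m < n1 & type_upto a (iter m F q0) /\ Q m (upd e u a).
Proof.
move=> dQ Q0 QS a aA.
pose P (e : nat -> M) := exists2 m, m \in iota 0 n1 &
  typed (fun x => ileq x (e u)) e (iter m F q0) /\ Q m e.
have dP : definable P.
  apply: definable_ex_in => m; apply: definable_and => //.
  exact: typed_definable.
have PE b : P (upd e u b) <-> exists2 m, m < n1 &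
    type_upto b (iter m F q0) /\ Q m (upd e u b).
  have K m : typed (fun x => ileq x (upd e u b u)) (upd e u b) (iter m F q0) <->
      type_upto b (iter m F q0).
    by rewrite /upd eqxx; split; apply: typed_sentence.
  split=> -[m lm [/K Tm Qm]]; exists m => //; last by rewrite mem_iota.
  by rewrite mem_iota in lm.
apply/PE; apply: (atom_induction M_models dP) aA => [b bmin|b c bc /PE[m lm [Tm Qm]]].
  apply/PE; exists 0; first by apply: leq_ltn_trans lt01.
  by split; [apply: type_least | apply: Q0].
have Tc : type_upto c (iter (next m) F q0) by rewrite iter_next; apply: type_succ Tm.
by apply/PE; exists (next m); [apply: next_lt | split=> //; apply: QS Tc Qm].
Qed.

(** Invariant along the atoms: the atom precedes [g n0], or its index is at least [n0]. The greatest
    atom does not precede [g n0]. *)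
Lemma greatest_in_loop g z : initseg n0.+1 g -> greatest_atom z ->
  exists2 m, n0 <= m < n1 & type_upto z (iter m F q0).
Proof.
move=> gn [zA zmax]; have [gA glt gx] := gn.
pose u := bound phi; have gn0A := gA n0 (ltnSn n0).
pose Q m (e : nat -> M) := ilhd (e u) (e u.+1) \/ n0 <= m.
have E a : (upd (fun=> g n0) u a u = a) * (upd (fun=> g n0) u a u.+1 = g n0).
  by rewrite /upd eqxx gtn_eqF.
have [|a [aA amin]|a b m lm [aA bA ab nab] Tb|m lm [Tm]] :=
    @lasso_induction (fun=> g n0) Q _ _ _ z zA.
- move=> m; rewrite /Q; apply: definable_or; last exact: definable_const.
  by exists (fLhd u u.+1).
- rewrite /Q !E; case: (amin _ gn0A) => [aE|]; last by left.
  right; case: (posnP n0) => [-> //|n0P]; case: (amin (g 0) (gA 0 isT)) => [a0|a0].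
    have [] := @initseg_neq _ M_models _ _ 0 n0 gn; first by rewrite n0P /=.
    by rewrite -a0.
  case: (ilhd_irrefl M_models aA (ilhd_trans M_models aA (gA 0 isT) aA a0 _)).
  by rewrite aE; apply: glt; rewrite n0P /=.
- rewrite /Q !E => -[ag|n0m]; last by right; rewrite /next; case: ifP; rewrite // leqW.
  case: (ilhd_total M_models bA gn0A) => [|bE|gb]; [by left | right |].
    (* The state of [g n0] is that of index [n0], so by uniqueness the new index is [n0]. *)
    rewrite bE in Tb.
    by rewrite (type_upto_inj (next_lt lm) lt01 Tb (type_nth gn)).
  by case: nab; exists (g n0).
rewrite /Q !E => -[zg|n0m]; last by exists m; rewrite // n0m.
case: (zmax _ gn0A) => [gz|gz].
  by case: (ilhd_irrefl M_models zA); rewrite -{2}gz.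
by case: (ilhd_irrefl M_models zA (ilhd_trans M_models zA gn0A zA zg gz)).
Qed.

Let d := n1 - n0.

Lemma modn_next m : m < n1 ->
  (next m %% d).+1 = if (m %% d).+1 < d then (m %% d).+2 else 1.
Proof.
move=> lm; have d0 : 0 < d by rewrite subn_gt0.
(* Wrapping around replaces [n1] by [n0], and these differ by the modulus [d]. *)
have -> : next m %% d = m.+1 %% d.
  rewrite /next; case: eqP => // ->.
  by rewrite -[in RHS](subnK (ltnW lt01)) modnDl.
have -> : m.+1 %% d = (m %% d).+1 %% d by rewrite -[m.+1]addn1 -[(m %% d).+1]addn1 modnDml.
case: ltnP => [lt|ge]; first by rewrite modn_small.
have -> : (m %% d).+1 = d by apply/eqP; rewrite eqn_leq ge ltn_pmod.
by rewrite modnn.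
Qed.

(** An atom of index [m] lies in the set numbered [(m %% d).+1]: the least atom has index 0 and lies
    in [B 1], and both numbers advance cyclically. At the greatest atom disjointness identifies this
    number with [h]. *)
Lemma residue_sets_type h (B : nat -> M) z : residue_sets d h B -> greatest_atom z ->
  0 < h <= d ->
  exists m, [/\ m < n1, type_upto z (iter m F q0) & (m %% d).+1 = h].
Proof.
move=> [_ _ disj [a amin a1] [Bsucc [z' [z'A z'max] z'h]]] [zA zmax] hd.
have E : z = z'.
  case: (zmax _ z'A) => [-> //|zz]; case: (z'max _ zA) => [//|zz'].
  by case: (ilhd_irrefl M_models zA (ilhd_trans M_models zA z'A zA zz' zz)).
have d0 : 0 < d by rewrite subn_gt0.
(* The variable [u.+1 + i] carries the set [B i] as a parameter. *)
pose u := bound phi; pose e v := B (v - u.+1).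
pose Q m (e : nat -> M) := isub (e u) (e (u.+1 + (m %% d).+1)).
have Eu a' : upd e u a' u = a' by rewrite /upd eqxx.
have EB a' i : upd e u a' (u.+1 + i) = B i.
  by rewrite /upd gtn_eqF ?leq_addr // /e addKn.
have [|b bmin|b c m lm bc _|m lm [Tm]] := @lasso_induction e Q _ _ _ z zA.
- by move=> m; exists (fSub u (u.+1 + (m %% d).+1)).
- rewrite /Q Eu EB mod0n; suff -> : b = a by [].
  case: amin bmin => aA amin [bA bmin].
  case: (amin _ bA) => // ab; case: (bmin _ aA) => // ba.
  by case: (ilhd_irrefl M_models aA (ilhd_trans M_models aA bA aA ab ba)).
- rewrite /Q !Eu !EB modn_next // => /(Bsucc _ _ bc); apply.
  by rewrite ltn_pmod.
rewrite /Q Eu EB => zm; exists m; split=> //.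
rewrite E in zm; have md : (m %% d).+1 <= d by rewrite ltn_pmod.
case/andP: hd => h0 hd.
case: (ltngtP (m %% d).+1 h) => // [lt|lt].
  by case: (disj z' z'A h (m %% d).+1).
by case: (disj z' z'A (m %% d).+1 h); rewrite ?h0.
Qed.

(** For [i] from 1 to [d], [B i] consists of the atoms whose index is congruent to [i.-1] modulo
    [d]. It is not bottom, since it contains the atom [g i.-1] of the initial segment. *)
Lemma exists_residue_sets g : initseg n1 g ->
  exists B : nat -> M, forall m z, m < n1 -> greatest_atom z ->
    type_upto z (iter m F q0) -> residue_sets d (m %% d).+1 B.
Proof.
move=> gn; have [gA glt gx] := gn.
have d0 : 0 < d by rewrite subn_gt0.
have dn1 : d <= n1 by apply: leq_subr.
pose u := bound phi.
pose P i (e : nat -> M) := exists2 m, m \in [seq m <- iota 0 n1 | (m %% d).+1 == i] &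
  typed (fun x => ileq x (e u)) e (iter m F q0).
have dP i : definable (P i).
  by apply: definable_ex_in => m; apply: typed_definable.
have exB i : exists X, forall x, iat x -> isub x X <->
    exists m, [/\ m < n1, (m %% d).+1 = i & type_upto x (iter m F q0)].
  have [X HX] := comprehension M_models bot u (dP i).
  exists X => x xA; apply: (iff_trans (HX x xA)); rewrite /P.
  have K m : typed (fun y => ileq y (upd bot u x u)) (upd bot u x) (iter m F q0) <->
      type_upto x (iter m F q0).
    by rewrite /upd eqxx; split; apply: typed_sentence.
  split=> [[m]|[m [lm mi Tm]]].
    by rewrite mem_filter mem_iota => /andP[/eqP mi lm] /K Tm; exists m.
  by exists m; [rewrite mem_filter mem_iota mi eqxx | apply/K].
have [B HB] : exists B : nat -> M, forall i, i <= d -> forall x, iat x ->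
    isub x (B i) <->
    exists m, [/\ m < n1, (m %% d).+1 = i & type_upto x (iter m F q0)].
  have [B HB] := fin_all_exists (fun i : 'I_d.+1 => exB i).
  (* The sets are chosen for indices up to [d]; [inord] gives larger ones a default value. *)
  exists (fun i => B (inord i)) => i id; have := HB (inord i).
  by rewrite inordK.
exists B => m z lm zmax Tm; split.
- move=> i /andP[i0 id] Bi.
  have li : i.-1 < n1 by rewrite prednK // (leq_trans id).
  apply: (atom_not_sub_bot M_models (gA _ li)); rewrite -Bi; apply/(HB _ id _ (gA _ li)).
  exists i.-1; split=> //; first by rewrite modn_small prednK.
  by apply: type_nth; apply: initseg_leq gn.
- move=> x xA.
  (* With a trivial invariant, [lasso_induction] says that every atom has an index. *)
  have [|a amin|a b k lk ab _|k lk [Tk _]] :=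
    @lasso_induction bot (fun _ _ => True) _ _ _ x xA => //.
    by move=> _; apply: definable_const.
  by exists (k %% d).+1; [rewrite ltn_pmod | apply/HB; rewrite ?ltn_pmod //; exists k].
- move=> x xA i j /andP[j0 ji] id [/HB xi /HB xj].
  have [//|//|k [lk ki Tk]] := xi.
  have [||l [ll lj Tl]] := xj; rewrite ?(leq_trans (ltnW ji)) //.
  by move: ji; rewrite -ki -lj (type_upto_inj lk ll Tk Tl) ltnn.
- have [a amin] := exists_least_atom M_models (gA 0 (leq_ltn_trans (leq0n _) lt01)).
  have [aA _] := amin; exists a => //; apply/HB => //.
  by exists 0; rewrite mod0n (leq_ltn_trans _ lt01) //; split=> //; apply: type_least.
split.
  move=> a b ab i /andP[i0 id]; have [aA bA _ _] := ab.
  move=> /HB[//|//|k [lk ki Tk]].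
  apply/HB => //; first by case: ifP.
  exists (next k); rewrite next_lt // modn_next // ki iter_next; split=> //.
  exact: type_succ Tk.
have [zA _] := zmax.
by exists z => //; apply/HB; rewrite ?ltn_pmod //; exists m.
Qed.

End Lasso.
End Sentence.

(** * The normal form of a sentence *)

Theorem theorem4p17 (phi : formula) (hphi : sentence phi) :
  exists (N d : nat) (I : {set 'I_N.+1}) (R : {set 'I_d.+1}),
    [/\ 0 < d,
        forall h, h \in R -> 0 < h
      & entails T_MSO_Fin
          (phi <-> (disj_over (enum I) (fun i => psi_eq i) \/
                    (psi_gt N /\ disj_over (enum R) (fun h => rho d h))))%fo].
Proof.
pose F : state phi -> state phi := step (fun=> false).
pose q0 := F (init phi).
have [n0 [n1 [lt01 loop inj]]] := eventually_periodic F q0.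
pose d := n1 - n0; have d0 : 0 < d by rewrite subn_gt0.
pose I := [set i : 'I_n1.+1 | accepting (iter i F (init phi))].
(* The residue numbers of the accepting indices on the loop; each class modulo [d] has exactly one
   index from [n0] to [n1.-1]. *)
pose R := [set h : 'I_d.+1 | [exists m : 'I_n1,
  [&& n0 <= m, (m %% d).+1 == h & accepting (iter m F q0)]]].
exists n1, d, I, R; split=> //.
  by move=> h; rewrite inE => /existsP[m /and3P[_ /eqP<- _]].
move=> M M_models e.
split=> [phiT|[|[/(psi_gtP M_models)[g gn]]]].
(* Either there are more than [n1] atoms, enough to enter the loop and to fill all residue sets, or
   their number is some [j] at most [n1]. *)
- case: (initseg_or_covers M_models n1.+1) => [[g gn]|[j jn [g gj gc]]].
    right; split; first exact: initseg_psi_gt gn.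
    have g0 : iat (g 0) by case: gn => gA _ _; apply: gA.
    have [z zmax] := exists_greatest_atom M_models g0.
    have [m /andP[n0m lm] Tm] := greatest_in_loop M_models hphi lt01 loop inj
      (initseg_leq (leqW lt01) gn) zmax.
    have [B HB] := exists_residue_sets M_models hphi lt01 loop inj
      (initseg_leq (leqnSn _) gn).
    have md : (m %% d).+1 <= d by rewrite ltn_pmod.
    apply/sat_disj_over; exists (inord (m %% d).+1).
      rewrite mem_enum inE; apply/existsP; exists (Ordinal lm).
      by rewrite /= n0m inordK // eqxx; apply/(type_greatest M_models hphi e zmax Tm).
    by rewrite inordK //; apply/sat_rho => //; exists B; apply: HB Tm.
  left; apply/sat_disj_over; exists (Ordinal jn).
    by rewrite mem_enum inE; apply/(accepting_covers M_models hphi e gj gc).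
  exact: covers_psi_eq gj gc.
- move=> /sat_disj_over[i]; rewrite mem_enum inE => acc /(psi_eqP M_models)[g gn gc].
  exact/(accepting_covers M_models hphi e gn gc).
- move=> /sat_disj_over[h]; rewrite mem_enum inE.
  move=> /existsP[m /and3P[n0m /eqP mh acc]].
  have hd : 0 < h <= d by rewrite -mh ltn_pmod.
  move=> /(sat_rho M_models e hd)[B HB].
  have g0 : iat (g 0) by case: gn => gA _ _; apply: gA.
  have [z zmax] := exists_greatest_atom M_models g0.
  (* The greatest atom gets an index [k] on the loop, and an index [l] congruent to [m] from the
     sets of [rho]; uniqueness gives [l = k]. *)
  have [k /andP[n0k lk] Tk] := greatest_in_loop M_models hphi lt01 loop inj
      (initseg_leq (leqW lt01) gn) zmax.
  have [l [ll Tl lh]] := residue_sets_type M_models hphi lt01 loop HB zmax hd.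
  apply/(type_greatest M_models hphi e zmax Tk).
  have lk_eq : l = k by apply: inj => //; apply: typed_inj Tl Tk.
  suff -> : k = m by [].
  have n0l : n0 <= l by rewrite lk_eq.
  (* Both [l] and [m] lie in an interval of length [d], so congruence modulo [d] is equality. *)
  have small i : n0 <= i -> i < n1 -> i - n0 < d by move=> ni lti; rewrite ltn_sub2r.
  have : l = m %[mod d] by apply: succn_inj; rewrite lh.
  rewrite -(subnKC n0l) -(subnKC n0m) => /eqP; rewrite eqn_modDl.
  rewrite !modn_small ?small // => /eqP E.
  by rewrite -lk_eq -(subnKC n0l) E subnKC.
Qed.
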